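(* In the projective plane $\mathrm{PG}(2,3)$, a set of points is a projective triangle of side $3$ if and only if it is a vertexless triangle. That is, the set of projective triangles of side $3$ in $\mathrm{PG}(2,3)$ coincides with the set of vertexless triangles in $\mathrm{PG}(2,3)$.
   Context: $\mathrm{PG}(2,q)$ denotes the Desarguesian projective plane of order $q$. A vertexless triangle: given three non-concurrent lines $a,b,c$, it is the set of all points lying on exactly one of $a,b,c$ (the points of the three sides without the three vertices); it has $3(q-1)$ points. A projective triangle of side $n$ in $\mathrm{PG}(2,q)$ is a set $\mathcal{B}$ of $3(n-1)$ points such that there is a triangle $P_0P_1P_2$ with: (i) each side of the triangle contains exactly $n$ points of $\mathcal{B}$; (ii) the vertices $P_0,P_1,P_2$ belong to $\mathcal{B}$; (iii) if $Q_0\in P_1P_2$ and $Q_1\in P_2P_0$ are in $\mathcal{B}$, then $Q_2=Q_0Q_1\cap P_0P_1$ is in $\mathcal{B}$. *)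

(* Defs.v *)
From HB Require Import structures.
From mathcomp Require Import all_boot all_order all_algebra.

Set Implicit Arguments.
Unset Strict Implicit.
Unset Printing Implicit Defensive.

Import GRing.Theory.
Local Open Scope ring_scope.

(* The subspaces of a finite vector space form a finType; the library only
   provides the choiceType structure. *)
Section FinVspace.
Import VectorInternalTheory.
Variables (F : finFieldType) (vT : vectType F).
HB.instance Definition _ := [Countable of {vspace vT} by <:].
HB.instance Definition _ := [Finite of {vspace vT} by <:].
End FinVspace.

(* PG(2,F): points and lines are the subspaces of F^3 of dimension 1 and 2,
   and incidence is inclusion of subspaces. *)
Definition pg_point (F : finFieldType) :=
  {U : {vspace 'rV[F]_3} | \dim U == 1%N}.
Definition pg_line (F : finFieldType) :=
  {U : {vspace 'rV[F]_3} | \dim U == 2%N}.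

Definition on_line (F : finFieldType) (P : pg_point F) (l : pg_line F) : bool :=
  (val P <= val l)%VS.

(* A line when P != Q; degenerates to the point itself when P = Q. *)
Definition join (F : finFieldType) (P Q : pg_point F) : {vspace 'rV[F]_3} :=
  (val P + val Q)%VS.

Definition collinear (F : finFieldType) (P Q R : pg_point F) : Prop :=
  exists l : pg_line F, [/\ on_line P l, on_line Q l & on_line R l].

Definition concurrent (F : finFieldType) (a b c : pg_line F) : Prop :=
  exists P : pg_point F, [/\ on_line P a, on_line P b & on_line P c].

Definition vertexless_triangle (F : finFieldType) (B : {set pg_point F}) : Prop :=
  exists a b c : pg_line F, ~ concurrent a b c /\
    B = [set P | on_line P a + on_line P b + on_line P c == 1]%N.

Definition points_of (F : finFieldType) (B : {set pg_point F})
    (U : {vspace 'rV[F]_3}) : {set pg_point F} :=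
  [set P in B | (val P <= U)%VS].

(* In the closure condition, the equation on Q2 says that Q0Q1 and P0P1 meet
   in the single point Q2. It has no solution in the two degenerate cases:
   Q0 = Q1 = P2 (zero intersection) and Q0 = P1, Q1 = P0 (the intersection is
   the whole side P0P1). *)
Definition projective_triangle (F : finFieldType) (n : nat)
    (B : {set pg_point F}) : Prop :=
  #|B| = (3 * (n - 1))%N /\
  exists P0 P1 P2 : pg_point F,
    [/\ ~ collinear P0 P1 P2,
        [/\ #|points_of B (join P1 P2)| = n,
            #|points_of B (join P2 P0)| = n
          & #|points_of B (join P0 P1)| = n],
        [/\ P0 \in B, P1 \in B & P2 \in B]
      & forall Q0 Q1 Q2 : pg_point F,
          Q0 \in points_of B (join P1 P2) ->
          Q1 \in points_of B (join P2 P0) ->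
          val Q2 = (join Q0 Q1 :&: join P0 P1)%VS ->
          Q2 \in B].

(* Main.v *)
Require Import Defs.
From HB Require Import structures.
From mathcomp Require Import all_boot all_order all_algebra.
From mathcomp Require Import finfield ring.

(** A projective triangle of side 3 consists of the three vertices and one more
    point on each side, and the closure condition makes these three extra points
    collinear.  After rescaling the vertices e0, e1, e2, the extra points are
    spanned by e1 - e2, e2 - e0 and e0 - e1, so the set is the set of six vertices
    of a complete quadrilateral.  A vertexless triangle with vertices f0, f1, f2
    is the set of points with exactly one zero coordinate in the basis f.  Over the
    field of order 3 the two descriptions agree under e_i = f_j + f_k, which is
    inverted by f_i = e_i - e_j - e_k because -2 = 1: the vertexless triangle is
    the one formed by the diagonals of the quadrilateral. *)

Set Implicit Arguments.
Unset Strict Implicit.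
Unset Printing Implicit Defensive.

Import GRing.Theory.

Lemma card_set_uniq (T : finType) (s : seq T) :
  uniq s -> #|[set x in s]| = size s.
Proof. by move=> uniq_s; rewrite cardsE; apply/card_uniqP. Qed.

Section Coordinates.
Local Open Scope ring_scope.
Variable F : finFieldType.

(* Naming this instance keeps unification from comparing the two convertible
   eqType structures on [pg_point F], which is very slow. *)
Definition point : finType := pg_point F.

Implicit Types (e f v w : 'rV[F]_3) (P Q : point) (B : {set point}).

(** * Points as spans of nonzero vectors *)

Fact dim_default_point : \dim <[const_mx 1 : 'rV[F]_3]>%VS == 1%N.
Proof.
rewrite dim_vline; suff -> : (const_mx 1 : 'rV[F]_3) != 0 by [].
by apply/eqP => /matrixP/(_ 0 0)/eqP; rewrite !mxE oner_eq0.
Qed.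

(* Junk value: [pt 0] is an arbitrary point. *)
Definition pt v : point :=
  (insubd (exist _ <[const_mx 1]>%VS dim_default_point) <[v]>%VS : pg_point F).

Lemma val_pt v : v != 0 -> val (pt v) = <[v]>%VS.
Proof. by move=> v0; rewrite /pt val_insubd dim_vline v0. Qed.

Lemma ptP P : exists2 v, v != 0 & P = pt v.
Proof.
have dP := eqP (valP P); exists (vpick (val P)).
  by rewrite vpick0 -dimv_eq0 dP.
apply: val_inj; rewrite val_pt ?vpick0 -?dimv_eq0 ?dP //.
apply/esym/eqP; rewrite eqEdim -memvE memv_pick dim_vline vpick0.
by rewrite -dimv_eq0 dP.
Qed.

Lemma pt_le v (U : {vspace 'rV[F]_3}) : v != 0 -> (val (pt v) <= U)%VS = (v \in U).
Proof. by move=> v0; rewrite val_pt // memvE. Qed.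

Lemma pt_eq v w : v != 0 -> w != 0 -> pt v = pt w -> exists k, v = k *: w.
Proof.
by move=> v0 w0 eq_vw; apply/vlineP; rewrite -(pt_le _ v0) eq_vw val_pt.
Qed.

Lemma ptZ k v : k != 0 -> pt (k *: v) = pt v.
Proof.
move=> k0; have [->|v0] := eqVneq v 0; first by rewrite scaler0.
apply: val_inj; rewrite !val_pt ?scaler_eq0 ?negb_or ?k0 //.
apply/eqP; rewrite eqEdim !dim_vline scaler_eq0 negb_or k0 v0 leqnn andbT.
by rewrite -memvE rpredZ ?memv_line.
Qed.

(** As long as the dimension is below 2, adjoin a nonzero vector of the complement. This supplies a
    genuine line through two points even when they coincide and their span is too small. *)
Lemma sub_pg_line (U : {vspace 'rV[F]_3}) :
  (\dim U <= 2)%N -> exists l : pg_line F, (U <= val l)%VS.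
Proof.
have [n] := ubnP (2 - \dim U)%N; elim: n U => // n IHn U ltUn leU2.
have [U2 | U2] := eqVneq (\dim U) 2%N.
  by exists (exist _ U (introT eqP U2)).
have dimUC : (\dim U^C > 0)%N.
  by rewrite dimv_compl dimvf /dim /= mul1n; case: (\dim U) leU2 => [|[|[|]]].
set v := vpick U^C.
have v0 : v != 0 by rewrite vpick0 -dimv_eq0 -lt0n.
have dUv : \dim (U + <[v]>) = (\dim U).+1.
  rewrite dimv_disjoint_sum ?dim_vline ?v0 ?addn1 //.
  apply/eqP; rewrite -subv0 -(capv_compl U) capvS // -memvE.
  exact: memv_pick.
have ltU2 : (\dim U < 2)%N by rewrite ltn_neqAle U2.
have [||l lP] := IHn (U + <[v]>)%VS; rewrite ?dUv //.
  by rewrite -ltnS (leq_trans _ ltUn) // ltnS ltn_sub2l.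
by exists l; apply: subv_trans lP; apply: addvSl.
Qed.

(** * Homogeneous coordinates with respect to three independent vectors *)

Definition comb e0 e1 e2 (x y z : F) := x *: e0 + y *: e1 + z *: e2.

Definition frame e0 e1 e2 := forall x y z,
  comb e0 e1 e2 x y z = 0 -> [/\ x = 0, y = 0 & z = 0].

(** The cyclic symmetry of the whole development: a fact proved for one vertex or one side passes to
    the other two by this rotation. *)
Lemma comb_rot e0 e1 e2 x y z : comb e0 e1 e2 x y z = comb e1 e2 e0 y z x.
Proof. by rewrite /comb -addrA addrC. Qed.

Lemma frame_rot e0 e1 e2 : frame e0 e1 e2 -> frame e1 e2 e0.
Proof. by move=> fr x y z; rewrite -comb_rot => /fr[]. Qed.

Lemma combZ k e0 e1 e2 x y z :
  k *: comb e0 e1 e2 x y z = comb e0 e1 e2 (k * x) (k * y) (k * z).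
Proof. by rewrite /comb !scalerDr !scalerA. Qed.

Lemma combD e0 e1 e2 x y z x' y' z' :
  comb e0 e1 e2 x y z + comb e0 e1 e2 x' y' z' =
  comb e0 e1 e2 (x + x') (y + y') (z + z').
Proof. by rewrite /comb !scalerDl addrACA [X in X + _]addrACA. Qed.

Lemma combB e0 e1 e2 x y z x' y' z' :
  comb e0 e1 e2 x y z - comb e0 e1 e2 x' y' z' =
  comb e0 e1 e2 (x - x') (y - y') (z - z').
Proof. by rewrite /comb !scalerBl !opprD addrACA [X in X + _]addrACA. Qed.


Lemma comb100 e0 e1 e2 : comb e0 e1 e2 1 0 0 = e0.
Proof. by rewrite /comb scale1r !scale0r !addr0. Qed.

Lemma comb010 e0 e1 e2 : comb e0 e1 e2 0 1 0 = e1.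
Proof. by rewrite comb_rot comb100. Qed.

Lemma comb001 e0 e1 e2 : comb e0 e1 e2 0 0 1 = e2.
Proof. by rewrite comb_rot comb010. Qed.

Lemma comb110 e0 e1 e2 : comb e0 e1 e2 1 (-1) 0 = e0 - e1.
Proof. by rewrite /comb scale1r scaleN1r scale0r addr0. Qed.

Lemma comb011 e0 e1 e2 : comb e0 e1 e2 0 1 (-1) = e1 - e2.
Proof. by rewrite comb_rot comb110. Qed.

Lemma comb101 e0 e1 e2 : comb e0 e1 e2 (-1) 0 1 = e2 - e0.
Proof. by rewrite comb_rot comb011. Qed.

Lemma frame_scale e0 e1 e2 k0 k1 k2 : k0 != 0 -> k1 != 0 -> k2 != 0 ->
  frame e0 e1 e2 -> frame (k0 *: e0) (k1 *: e1) (k2 *: e2).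
Proof.
move=> k0n k1n k2n fr x y z; rewrite /comb !scalerA => /fr[/eqP + /eqP + /eqP].
rewrite !mulf_eq0 (negPf k0n) (negPf k1n) (negPf k2n) !orbF.
by move=> /eqP-> /eqP-> /eqP->.
Qed.

(** A linear relation in which [u0] has a nonzero coefficient puts [u0] in the span of [u1] and
    [u2], hence on a line through both. The other two coefficients follow by rotation. *)
Lemma noncollinear_frame e0 e1 e2 : e0 != 0 -> e1 != 0 -> e2 != 0 ->
  ~ collinear (pt e0) (pt e1) (pt e2) -> frame e0 e1 e2.
Proof.
have indep u0 u1 u2 x y z : u0 != 0 -> u1 != 0 -> u2 != 0 ->
    ~ collinear (pt u0) (pt u1) (pt u2) -> comb u0 u1 u2 x y z = 0 -> x = 0.
  move=> u0n u1n u2n ncol comb0; apply/eqP; apply/negP => /negP xn; apply: ncol.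
  have [|l ul] := @sub_pg_line (<[u1]> + <[u2]>)%VS.
    by rewrite (leq_trans (dimv_add_leqif _ _)) // !dim_vline u1n u2n.
  have u1l : u1 \in val l by rewrite memvE (subv_trans (addvSl _ _) ul).
  have u2l : u2 \in val l by rewrite memvE (subv_trans (addvSr _ _) ul).
  exists l; rewrite /on_line !pt_le //; split=> //.
  have -> : u0 = - x^-1 *: (y *: u1 + z *: u2).
    rewrite -[LHS](scalerK xn) scaleNr -scalerN; congr (_ *: _).
    by apply/eqP; rewrite -addr_eq0 addrA; apply/eqP.
  by rewrite rpredZ // rpredD // rpredZ.
move=> e0n e1n e2n ncol x y z comb0.
have ncol1 : ~ collinear (pt e1) (pt e2) (pt e0).
  by case=> l [? ? ?]; apply: ncol; exists l.
have ncol2 : ~ collinear (pt e2) (pt e0) (pt e1).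
  by case=> l [? ? ?]; apply: ncol; exists l.
split; first exact: indep comb0.
  by apply: (indep e1 e2 e0 y z x); rewrite // -comb_rot.
by apply: (indep e2 e0 e1 z x y); rewrite // -2!comb_rot.
Qed.

Section Frame.
Variables e0 e1 e2 : 'rV[F]_3.
Hypothesis fr : frame e0 e1 e2.
Local Notation cmb := (comb e0 e1 e2).

Lemma comb_eq0 x y z : (cmb x y z == 0) = [&& x == 0, y == 0 & z == 0].
Proof.
apply/eqP/and3P => [/fr[-> -> ->] | [/eqP-> /eqP-> /eqP->]]; first by rewrite eqxx.
by rewrite /comb !scale0r !addr0.
Qed.

Lemma frame_neq0 : [/\ e0 != 0, e1 != 0 & e2 != 0].
Proof.
by split; [rewrite -(comb100 e0 e1 e2) | rewrite -(comb010 e0 e1 e2)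
  | rewrite -(comb001 e0 e1 e2)]; rewrite comb_eq0 oner_eq0 ?andbF.
Qed.

Lemma comb_inj x y z x' y' z' :
  cmb x y z = cmb x' y' z' -> [/\ x = x', y = y' & z = z'].
Proof.
move/eqP; rewrite -subr_eq0 combB comb_eq0 !subr_eq0.
by case/and3P=> /eqP-> /eqP-> /eqP->.
Qed.

Lemma frame_span v : exists x y z, v = cmb x y z.
Proof.
pose X := [tuple e0; e1; e2].
have freeX : free X.
  apply/freeP => k; rewrite !big_ord_recl big_ord0 addr0 /= addrA => /fr[k0 k1 k2].
  case=> -[|[|[|//]]] lti; [rewrite -[RHS]k0 | rewrite -[RHS]k1 | rewrite -[RHS]k2];
    by congr (k _); apply: val_inj.
have basX : basis_of fullv X.
  by rewrite basisEfree freeX subvf dimvf /dim /= mul1n.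
exists (coord X 0 v), (coord X (lift 0 0) v), (coord X (lift 0 (lift 0 0)) v).
by rewrite {1}(coord_basis basX (memvf v)) !big_ord_recl big_ord0 addr0 /= addrA.
Qed.

(** A line through the three points would contain every combination of the frame, that is, all of
    the 3-dimensional space. *)
Lemma frame_noncollinear : ~ collinear (pt e0) (pt e1) (pt e2).
Proof.
have [e0n e1n e2n] := frame_neq0.
case=> l []; rewrite /on_line !pt_le // => l0 l1 l2.
have lf : val l = fullv.
  apply/eqP; rewrite eqEsubv subvf /=; apply/subvP => v _.
  have [x [y [z ->]]] := frame_span v.
  by rewrite /comb !rpredD // rpredZ.
by have := valP l; rewrite /= lf dimvf.
Qed.

Lemma comb_mem12 x y z : (cmb x y z \in <[e1]> + <[e2]>)%VS = (x == 0).
Proof.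
apply/memv_addP/eqP => [[_ /vlineP[k ->] [_ /vlineP[k' ->]]] | ->].
  rewrite -[k *: e1 + _]add0r -(scale0r e0) addrA => /comb_inj[] //.
exists (y *: e1); first by rewrite memvZ ?memv_line.
exists (z *: e2); first by rewrite memvZ ?memv_line.
by rewrite /comb scale0r add0r.
Qed.

Lemma pt_frame P : exists x y z, cmb x y z != 0 /\ P = pt (cmb x y z).
Proof.
have [v v0 ->] := ptP P; have [x [y [z def_v]]] := frame_span v.
by exists x, y, z; rewrite -def_v.
Qed.

End Frame.

Lemma comb_mem20 e0 e1 e2 x y z : frame e0 e1 e2 ->
  (comb e0 e1 e2 x y z \in <[e2]> + <[e0]>)%VS = (y == 0).
Proof. by move=> fr; rewrite comb_rot comb_mem12 //; apply: frame_rot. Qed.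

Lemma comb_mem01 e0 e1 e2 x y z : frame e0 e1 e2 ->
  (comb e0 e1 e2 x y z \in <[e0]> + <[e1]>)%VS = (z == 0).
Proof. by move=> fr; rewrite comb_rot comb_mem20 //; apply: frame_rot. Qed.

(** Also [x != 0], since otherwise the two equations kill [y] and [z] as well. The scalar that
    relates the vectors is then [x / x']. *)
Lemma pt_comb_proportional e0 e1 e2 x y z x' y' z' : frame e0 e1 e2 ->
  comb e0 e1 e2 x y z != 0 -> x' != 0 ->
  x * y' = x' * y -> x * z' = x' * z ->
  pt (comb e0 e1 e2 x y z) = pt (comb e0 e1 e2 x' y' z').
Proof.
move=> fr vn x'n xy xz.
have xn : x != 0.
  apply: contraNneq vn => x0; rewrite comb_eq0 // x0 eqxx /=.
  move: xy xz; rewrite x0 !mul0r => /esym/eqP + /esym/eqP.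
  by rewrite !mulf_eq0 (negPf x'n) /= => -> ->.
rewrite -[RHS](@ptZ (x / x')) ?mulf_neq0 ?invr_eq0 // combZ divfK //.
by rewrite (mulrAC x _ y') (mulrAC x _ z') xy xz !(mulrC x') !mulfK.
Qed.

(** Proportionality as the vanishing of all 2 by 2 minors. For the converse, a nonzero coordinate of
    the second vector is rotated into first position. *)
Lemma pt_comb_eq e0 e1 e2 x y z x' y' z' : frame e0 e1 e2 ->
  comb e0 e1 e2 x y z != 0 -> comb e0 e1 e2 x' y' z' != 0 ->
  (pt (comb e0 e1 e2 x y z) == pt (comb e0 e1 e2 x' y' z')) =
  [&& x * y' == x' * y, y * z' == y' * z & z * x' == z' * x].
Proof.
move=> fr vn wn; apply/eqP/and3P => [/(pt_eq vn wn)[k] | [/eqP xy /eqP yz /eqP zx]].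
  rewrite combZ => /(comb_inj fr)[-> -> ->].
  by split; apply/eqP; ring.
have fr1 := frame_rot fr; have fr2 := frame_rot fr1.
have [x'n | x'0] := boolP (x' != 0).
  by apply: pt_comb_proportional => //; rewrite mulrC -zx mulrC.
have [y'n | y'0] := boolP (y' != 0).
  rewrite comb_rot [in RHS]comb_rot; rewrite comb_rot in vn.
  by apply: pt_comb_proportional => //; rewrite mulrC -xy mulrC.
rewrite 2!comb_rot [in RHS]comb_rot [in RHS]comb_rot; rewrite 2!comb_rot in vn.
apply: pt_comb_proportional => //; last by rewrite mulrC -yz mulrC.
apply: contraNneq wn => z'0.
by rewrite comb_eq0 // z'0 (negbNE x'0) (negbNE y'0) eqxx.
Qed.

(** * Vertexless triangles in coordinates *)

Definition in_frame e0 e1 e2 (p : F -> F -> F -> bool) B :=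
  forall x y z, comb e0 e1 e2 x y z != 0 -> (pt (comb e0 e1 e2 x y z) \in B) = p x y z.

Definition one_zero (x y z : F) := ((x == 0)%R + (y == 0)%R + (z == 0)%R == 1)%N.

(** The frame consists of the three vertices, so that each side is the zero locus of the coordinate
    of the opposite vertex. Lying on exactly one side then means having exactly one zero
    coordinate. *)
Lemma vertexless_triangle_frame B :
  vertexless_triangle B <->
  exists e0 e1 e2, frame e0 e1 e2 /\ in_frame e0 e1 e2 one_zero B.
Proof.
split=> [[a [b [c [nconc ->]]]] | [e0 [e1 [e2 [fr BE]]]]].
  (* Two lines meet: otherwise their sum would have dimension 4 inside a space of dimension 3. *)
  have meet (l m : pg_line F) : exists2 v, v != 0 & v \in val l /\ v \in val m.
    set U := (val l :&: val m)%VS.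
    exists (vpick U).
      rewrite vpick0 -dimv_eq0; apply/eqP => U0.
      have := dimv_sum_cap (val l) (val m).
      rewrite -/U U0 addn0 (eqP (valP l)) (eqP (valP m)) => lm4.
      by have := dimvS (subvf (val l + val m)%VS); rewrite lm4 dimvf /dim /= mul1n.
    by have := memv_pick U; rewrite memv_cap => /andP[].
  have [e0 e0n [e0b e0c]] := meet b c.
  have [e1 e1n [e1c e1a]] := meet c a.
  have [e2 e2n [e2a e2b]] := meet a b.
  (* The vertex [u0] lies on [l'] and [l''], so by non-concurrence it is off [l]. Membership in [l]
     is therefore decided by the coefficient of [u0]. *)
  have side u0 u1 u2 (l l' l'' : pg_line F) x y z : u0 != 0 ->
      u1 \in val l -> u2 \in val l -> u0 \in val l' -> u0 \in val l'' ->
      ~ concurrent l l' l'' -> (comb u0 u1 u2 x y z \in val l) = (x == 0).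
    move=> u0n u1l u2l u0l' u0l'' nc.
    rewrite /comb -addrA rpredDr; last by rewrite rpredD ?rpredZ.
    have [->|xn] := eqVneq x 0; first by rewrite scale0r rpred0.
    apply/negP => xu0; apply: nc; exists (pt u0).
    by rewrite /on_line !pt_le //; split=> //; rewrite -(scalerK xn u0) rpredZ.
  have memP x y z : [/\ (comb e0 e1 e2 x y z \in val a) = (x == 0),
      (comb e0 e1 e2 x y z \in val b) = (y == 0)
    & (comb e0 e1 e2 x y z \in val c) = (z == 0)].
    split; first exact: (side _ _ _ a b c).
      rewrite comb_rot; apply: (side _ _ _ b c a) => //.
      by case=> P [? ? ?]; apply: nconc; exists P.
    rewrite 2!comb_rot; apply: (side _ _ _ c a b) => //.
    by case=> P [? ? ?]; apply: nconc; exists P.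
  (* Independence: the zero vector lies on all three sides, so all of its coordinates vanish. *)
  exists e0, e1, e2; split=> [x y z v0 | x y z v0].
    have [] := memP x y z; rewrite v0 !mem0v.
    by move=> /esym/eqP-> /esym/eqP-> /esym/eqP->.
  by rewrite inE /on_line !pt_le //; have [-> -> ->] := memP x y z.
have side u0 u1 u2 : frame u0 u1 u2 -> exists l : pg_line F, forall x y z,
    (comb u0 u1 u2 x y z \in val l) = (x == 0).
  move=> fru; have [u0n u1n u2n] := frame_neq0 fru.
  have dU : \dim (<[u1]> + <[u2]>)%VS == 2%N.
    rewrite dimv_disjoint_sum ?dim_vline ?u1n ?u2n //.
    apply/eqP; rewrite -subv0; apply/subvP => v.
    rewrite memv_cap => /andP[/vlineP[k ->] /vlineP[k' eq_kk']].
    have [|_ -> _] := fru 0 k (- k'); last by rewrite scale0r mem0v.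
    by rewrite /comb eq_kk' scale0r add0r scaleNr subrr.
  by exists (exist _ (<[u1]> + <[u2]>)%VS dU) => x y z; rewrite comb_mem12.
have [a aP] := side _ _ _ fr.
have [b bP] := side _ _ _ (frame_rot fr).
have [c cP] := side _ _ _ (frame_rot (frame_rot fr)).
have onP x y z : comb e0 e1 e2 x y z != 0 ->
    (on_line (pt (comb e0 e1 e2 x y z)) a = (x == 0)) *
    (on_line (pt (comb e0 e1 e2 x y z)) b = (y == 0)) *
    (on_line (pt (comb e0 e1 e2 x y z)) c = (z == 0)).
  move=> v0; rewrite /on_line !pt_le //.
  by rewrite aP [in X in X \in val b]comb_rot bP 2!comb_rot cP.
exists a, b, c; split.
  case=> P []; have [x [y [z [v0 ->]]]] := pt_frame fr P.
  rewrite !onP // => x0 y0 z0; move: v0.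
  by rewrite comb_eq0 // x0 y0 z0.
apply/setP => P; have [x [y [z [v0 ->]]]] := pt_frame fr P.
by rewrite BE // inE !onP.
Qed.

(** * The vertex set of a complete quadrilateral *)

Definition quadrilateral e0 e1 e2 : seq point :=
  [:: pt e0; pt e1; pt e2; pt (e1 - e2); pt (e2 - e0); pt (e0 - e1)].

(** At least two of the four forms [x], [y], [z], [x + y + z] vanish; these are the equations of the
    four lines of the quadrilateral. The disjuncts follow the order of the points in
    [quadrilateral]. The predicate also holds at the origin, which represents no point. *)
Definition on_quadrilateral (x y z : F) :=
  [|| (y == 0) && (z == 0), (z == 0) && (x == 0), (x == 0) && (y == 0),
      (x == 0) && (y + z == 0), (y == 0) && (z + x == 0) | (z == 0) && (x + y == 0)].

Lemma quadrilateral_comb e0 e1 e2 : quadrilateral e0 e1 e2 =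
  [:: pt (comb e0 e1 e2 1 0 0); pt (comb e0 e1 e2 0 1 0); pt (comb e0 e1 e2 0 0 1);
      pt (comb e0 e1 e2 0 1 (-1)); pt (comb e0 e1 e2 (-1) 0 1);
      pt (comb e0 e1 e2 1 (-1) 0)].
Proof. by rewrite comb100 comb010 comb001 comb011 comb101 comb110. Qed.

Lemma mem_quadrilateral e0 e1 e2 x y z : frame e0 e1 e2 ->
  comb e0 e1 e2 x y z != 0 ->
  (pt (comb e0 e1 e2 x y z) \in quadrilateral e0 e1 e2) = on_quadrilateral x y z.
Proof.
move=> fr v0; rewrite quadrilateral_comb !inE.
rewrite !pt_comb_eq // ?comb_eq0 ?oppr_eq0 ?oner_eq0 ?andbF //.
rewrite !(mulr0, mul0r, mulr1, mul1r, mulrN1, mulN1r, eqxx) /on_quadrilateral.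
rewrite !(eq_sym 0) !oppr_eq0 !addr_eq0 !eqr_oppLR.
case: (x == 0); case: (y == 0); case: (z == 0); rewrite ?andbF ?andbT ?orbF ?orbT //.
Qed.

(** The six coordinate vectors have pairwise different sets of zero positions, so they span
    different points in every characteristic. *)
Lemma uniq_quadrilateral e0 e1 e2 : frame e0 e1 e2 -> uniq (quadrilateral e0 e1 e2).
Proof.
move=> fr; rewrite quadrilateral_comb /= !inE.
rewrite !pt_comb_eq // ?comb_eq0 ?oppr_eq0 ?oner_eq0 ?andbF //.
by rewrite !(mulr0, mul0r, mulr1, mul1r, mulrN1, mulN1r, eqxx, eq_sym 0, oppr0,
  oppr_eq0, oner_eq0, andbF).
Qed.

Lemma card_quadrilateral e0 e1 e2 : frame e0 e1 e2 ->
  #|[set P in quadrilateral e0 e1 e2]| = 6%N.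
Proof.
by move=> fr; rewrite (card_set_uniq (uniq_quadrilateral fr)).
Qed.

(** An equality of sets and not of sequences: rotation permutes cyclically the three vertices and,
    separately, the three extra points. *)
Lemma quadrilateral_rot e0 e1 e2 :
  [set P in quadrilateral e0 e1 e2] = [set P in quadrilateral e1 e2 e0].
Proof.
have mem_rot (T : eqType) (a b c d e f P : T) :
    (P \in [:: a; b; c; d; e; f]) = (P \in [:: b; c; a; e; f; d]).
  by rewrite !inE; do 6!case: (P == _).
apply/setP => P; rewrite [LHS]in_set [RHS]in_set.
exact: mem_rot.
Qed.

Lemma vertex_quadrilateral e0 e1 e2 : pt e0 \in [set P in quadrilateral e0 e1 e2].
Proof. by rewrite in_set mem_head. Qed.

Lemma in_frame_quadrilateral e0 e1 e2 B : frame e0 e1 e2 ->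
  in_frame e0 e1 e2 on_quadrilateral B <-> B = [set P in quadrilateral e0 e1 e2].
Proof.
move=> fr; split=> [BE | -> x y z v0]; last by rewrite inE mem_quadrilateral.
apply/setP => P; have [x [y [z [v0 ->]]]] := pt_frame fr P.
by rewrite BE // inE mem_quadrilateral.
Qed.

(** Of the six points, exactly [pt e1], [pt e2] and [pt (e1 - e2)] have first coordinate zero. *)
Lemma card_side_quadrilateral e0 e1 e2 : frame e0 e1 e2 ->
  #|points_of [set P in quadrilateral e0 e1 e2] (join (pt e1) (pt e2))| = 3%N.
Proof.
move=> fr; have [e0n e1n e2n] := frame_neq0 fr.
rewrite /join !val_pt //; set U := (_ + _)%VS.
have -> : points_of [set P in quadrilateral e0 e1 e2] U =
    [set P in [seq P <- quadrilateral e0 e1 e2 | (val P <= U)%VS]].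
  apply/setP => P.
  by rewrite in_set [X in X && _]in_set [RHS]in_set (mem_filter _ (P : point)) andbC.
rewrite (card_set_uniq (filter_uniq _ (uniq_quadrilateral fr))).
rewrite quadrilateral_comb /=.
rewrite !pt_le ?comb_eq0 ?oppr_eq0 ?oner_eq0 ?andbF // !comb_mem12 //.
by rewrite oppr_eq0 oner_eq0 eqxx.
Qed.

Lemma mem_points_of P B U : (P \in points_of B U) = (P \in B) && (val P <= U)%VS.
Proof. by rewrite in_set. Qed.

(** Write [P0] as (0, y, z), [P1] as (x', 0, z') and [P2] as (a, b, 0). If [a] or [b] is zero, then
    [P2] is a vertex. Otherwise [y] and [x'] are nonzero, which leaves for [P0] only [pt e1] or the
    extra point of its side, and for [P1] only [pt e0] or the extra point of its side. *)
Lemma quadrilateral_closed e0 e1 e2 P0 P1 P2 : frame e0 e1 e2 ->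
  P0 \in points_of [set P in quadrilateral e0 e1 e2] (join (pt e1) (pt e2)) ->
  P1 \in points_of [set P in quadrilateral e0 e1 e2] (join (pt e2) (pt e0)) ->
  val P2 = (join P0 P1 :&: join (pt e0) (pt e1))%VS ->
  P2 \in [set P in quadrilateral e0 e1 e2].
Proof.
move=> fr; have [e0n e1n e2n] := frame_neq0 fr.
rewrite !mem_points_of !in_set /join !val_pt //.
have [x [y [z [v0 ->]]]] := pt_frame fr P0.
have [x' [y' [z' [v0' ->]]]] := pt_frame fr P1.
have [a [b [c [w0 ->]]]] := pt_frame fr P2.
rewrite !mem_quadrilateral // !pt_le // !val_pt // comb_mem12 //.
rewrite comb_mem20 //.
case/andP=> pQ0 /eqP x0; case/andP=> pQ1 /eqP y'0 meet; subst x y'.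
have := memv_line (comb e0 e1 e2 a b c).
rewrite meet memv_cap => /andP[/memv_addP[_ /vlineP[k ->] [_ /vlineP[l ->] vE]]].
rewrite comb_mem01 // => /eqP c0.
move: vE; rewrite !combZ combD => /(comb_inj fr).
rewrite !mulr0 add0r addr0 c0 => -[aE bE /esym/eqP kz_lz'].
rewrite /on_quadrilateral eqxx /= andbT.
have [// | bn] /= := eqVneq b 0.
have [// | an] /= := eqVneq a 0.
have [kn yn] : k != 0 /\ y != 0 by apply/andP; rewrite -negb_or -mulf_eq0 -bE.
have [ln x'n] : l != 0 /\ x' != 0 by apply/andP; rewrite -negb_or -mulf_eq0 -aE.
move: pQ0 pQ1; rewrite /on_quadrilateral eqxx (negPf yn) (negPf x'n) /= !(add0r, addr0).
rewrite (negPf yn) (negPf x'n) !(andbF, orbF) /=.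
have [z0 _ | zn /= /eqP yz] := eqVneq z 0.
  have [z'0 _ | z'n _] := eqVneq z' 0; last first.
    by move: kz_lz'; rewrite z0 mulr0 add0r mulf_eq0 (negPf ln) (negPf z'n).
  (* Here [P0] and [P1] are the vertices [pt e1] and [pt e0], so the intersection is a whole side.
     It contains (0, y, 0) besides (a, b, 0), against its being a single point. *)
  have : comb e0 e1 e2 0 y 0 \in <[comb e0 e1 e2 a b c]>%VS.
    rewrite meet memv_cap comb_mem01 // eqxx andbT -z0.
    by rewrite memvE (subv_trans _ (addvSl _ _)).
  case/vlineP=> m; rewrite combZ => /(comb_inj fr)[/esym/eqP + yE _].
  rewrite mulf_eq0 (negPf an) orbF => /eqP m0.
  by move: yn; rewrite yE m0 mul0r eqxx.
have [z'0 _ | z'n /= /eqP zx'] := eqVneq z' 0.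
  by move: kz_lz'; rewrite z'0 mulr0 addr0 mulf_eq0 (negPf kn) (negPf zn).
(* Both points are now the extra ones: with [z = - y] and [z' = - x'], the relation
   [k * z + l * z' = 0] becomes [a + b = 0]. *)
rewrite aE bE -oppr_eq0 -(eqP kz_lz') -subr_eq0.
have -> : z = - y by apply/eqP; rewrite -addr_eq0 addrC yz.
have -> : z' = - x' by apply/eqP; rewrite -addr_eq0 zx'.
by apply/eqP; ring.
Qed.

(** * Projective triangles of side 3, over any finite field *)

Lemma quadrilateral_projective_triangle e0 e1 e2 : frame e0 e1 e2 ->
  projective_triangle 3 [set P in quadrilateral e0 e1 e2].
Proof.
move=> fr; have [e0n e1n e2n] := frame_neq0 fr.
split; first exact: card_quadrilateral.
exists (pt e0), (pt e1), (pt e2); split; first exact: frame_noncollinear.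
- split; first exact: card_side_quadrilateral.
    by rewrite quadrilateral_rot card_side_quadrilateral //; apply: frame_rot.
  rewrite quadrilateral_rot quadrilateral_rot card_side_quadrilateral //.
  exact/frame_rot/frame_rot.
- split; first exact: vertex_quadrilateral.
    by rewrite quadrilateral_rot vertex_quadrilateral.
  by rewrite quadrilateral_rot quadrilateral_rot vertex_quadrilateral.
move=> Q0 Q1 Q2; exact: quadrilateral_closed.
Qed.

Lemma third_point e0 e1 e2 B : frame e0 e1 e2 ->
  #|points_of B (join (pt e1) (pt e2))| = 3%N ->
  exists y z, [/\ y != 0, z != 0 & pt (y *: e1 + z *: e2) \in B].
Proof.
move=> fr card3; have [e0n e1n e2n] := frame_neq0 fr.
set A := points_of _ _ in card3.
have : (0 < #|A :\: [set pt e1; pt e2]|)%N.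
  (* Removing the two vertices takes away at most two of the three points of the side. *)
  rewrite cardsD card3 subn_gt0 ltnS (leq_trans (subset_leq_card (subsetIr _ _))) //.
  by rewrite cards2; case: (_ == _).
case/card_gt0P=> R; rewrite in_setD in_set2 negb_or => /andP[/andP[R1 R2]].
rewrite mem_points_of => /andP[RB].
have [x [y [z [v0 RE]]]] := pt_frame fr R.
rewrite RE pt_le // /join !val_pt // comb_mem12 // => /eqP x0.
have vE : comb e0 e1 e2 x y z = y *: e1 + z *: e2 by rewrite /comb x0 scale0r add0r.
rewrite vE in RE v0; exists y, z; rewrite -RE; split=> //.
  apply: contraNneq R2 => y0; move: v0 RE; rewrite y0 scale0r add0r.
  by rewrite scaler_eq0 negb_or => /andP[zn _] ->; rewrite ptZ.
apply: contraNneq R1 => z0; move: v0 RE; rewrite z0 scale0r addr0.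
by rewrite scaler_eq0 negb_or => /andP[yn _] ->; rewrite ptZ.
Qed.

Lemma pt_sub_side e0 e1 e2 : frame e0 e1 e2 ->
  (val (pt (e1 - e2)) <= join (pt e1) (pt e2))%VS.
Proof.
move=> fr; have [e0n e1n e2n] := frame_neq0 fr.
rewrite /join [val (pt e1)]val_pt // [val (pt e2)]val_pt // -(comb011 e0 e1 e2).
by rewrite pt_le ?comb_eq0 ?oppr_eq0 ?oner_eq0 ?andbF // comb_mem12.
Qed.

(** The sum of [e1 - e2] and [e2 - e0] is [- (e0 - e1)]. Conversely, a combination of these two
    vectors with third coordinate zero has equal coefficients. The equality of subspaces is the form
    that the closure condition takes as premise. *)
Lemma meet_quadrilateral e0 e1 e2 : frame e0 e1 e2 ->
  val (pt (e0 - e1)) =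
  (join (pt (e1 - e2)) (pt (e2 - e0)) :&: join (pt e0) (pt e1))%VS.
Proof.
move=> fr; have [e0n e1n e2n] := frame_neq0 fr.
rewrite -(comb011 e0 e1 e2) -(comb101 e0 e1 e2) -(comb110 e0 e1 e2).
rewrite /join !val_pt ?comb_eq0 ?oppr_eq0 ?oner_eq0 ?andbF //.
apply/eqP; rewrite eqEsubv; apply/andP; split.
  rewrite -memvE memv_cap comb_mem01 // eqxx andbT.
  rewrite -memvN -scaleN1r combZ.
  have -> : comb e0 e1 e2 (-1 * 1) (-1 * -1) (-1 * 0) =
     comb e0 e1 e2 0 1 (-1) + comb e0 e1 e2 (-1) 0 1.
    by rewrite combD; congr comb; ring.
  by rewrite memv_add ?memv_line.
apply/subvP => v; rewrite memv_cap.
case/andP=> /memv_addP[_ /vlineP[k ->] [_ /vlineP[l ->] ->]].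
rewrite !combZ combD comb_mem01 // => kl0; apply/vlineP; exists (- l).
have -> : l = k by apply/eqP; rewrite -subr_eq0 -(eqP kl0); apply/eqP; ring.
by rewrite combZ; congr comb; ring.
Qed.

(** Extra points on two sides fix the scaling of the vertices, closure then yields the extra point
    of the third side, and a cardinality count leaves room for nothing else. *)
Lemma projective_triangle_quadrilateral B : projective_triangle 3 B <->
  exists e0 e1 e2, frame e0 e1 e2 /\ B = [set P in quadrilateral e0 e1 e2].
Proof.
split=> [| [e0 [e1 [e2 [fr ->]]]]]; last exact: quadrilateral_projective_triangle.
case=> cardB [P0 [P1 [P2 [ncol [card12 card20 _] [P0B P1B P2B] clB]]]].
have [u0 u0n P0E] := ptP P0; have [u1 u1n P1E] := ptP P1; have [u2 u2n P2E] := ptP P2.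
subst P0 P1 P2.
have fru := noncollinear_frame u0n u1n u2n ncol.
have [y [z [yn zn R0B]]] := third_point fru card12.
have [d [a [dn an R1B]]] := third_point (frame_rot fru) card20.
(* The scalars are forced by the extra points: [e1 - e2] must be [y *: u1 + z *: u2], and [e2 - e0]
   must be a multiple of [d *: u2 + a *: u0]. Comparing the coefficients of [u2] gives the factor
   [- (z / d)], hence [z * a / d] for [u0]. *)
have zan : z * a / d != 0 by rewrite !mulf_neq0 ?invr_eq0.
have nzn : - z != 0 by rewrite oppr_eq0.
have fr := frame_scale zan yn nzn fru.
exists ((z * a / d) *: u0), (y *: u1), ((- z) *: u2); split=> //.
set e0 := _ *: u0 in fr *; set e1 := _ *: u1 in fr *; set e2 := _ *: u2 in fr *.
have e0B : pt e0 \in B by rewrite ptZ.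
have e1B : pt e1 \in B by rewrite ptZ.
have e2B : pt e2 \in B by rewrite ptZ.
have e12B : pt (e1 - e2) \in B by rewrite /e1 /e2 scaleNr opprK.
have e20B : pt (e2 - e0) \in B.
  rewrite -(@ptZ (- (z / d))) ?oppr_eq0 ?mulf_neq0 ?invr_eq0 // in R1B.
  suff -> : e2 - e0 = - (z / d) *: (d *: u2 + a *: u0) by [].
  rewrite scalerDr !scalerA /e2 /e0 -[X in _ + X]scaleNr.
  by congr (_ *: _ + _ *: _); field.
have e01B : pt (e0 - e1) \in B.
  have [e0n e1n e2n] := frame_neq0 fr.
  move: clB; rewrite -(ptZ u0 zan) -(ptZ u1 yn) -(ptZ u2 nzn) -/e0 -/e1 -/e2 => clB.
  apply: (clB (pt (e1 - e2)) (pt (e2 - e0))); last exact: meet_quadrilateral fr.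
    by rewrite mem_points_of e12B (pt_sub_side fr).
  by rewrite mem_points_of e20B (pt_sub_side (frame_rot fr)).
(* The quadrilateral has six points and so has [B], so inclusion gives equality. *)
have sub : {subset quadrilateral e0 e1 e2 <= B}.
  by apply/allP; rewrite /= e0B e1B e2B e12B e20B e01B.
apply/esym/eqP; rewrite eqEcard (card_quadrilateral fr) cardB leqnn andbT.
by apply/subsetP => P; rewrite in_set => /sub.
Qed.

End Coordinates.

(** * The change of frame over the field of order 3 *)

Section OrderThree.
Local Open Scope ring_scope.
Variable F : finFieldType.
Hypothesis card_F : #|F| = 3%N.

(** Every element is a root of [x ^+ 3 - x], which splits into three linear factors. *)
Lemma order3_cases (x : F) : [\/ x = 0, x = 1 | x = -1].
Proof.
have := expf_card x; rewrite card_F => /eqP; rewrite -subr_eq0.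
have -> : x ^+ 3 - x = x * ((x - 1) * (x + 1)) by ring.
rewrite !mulf_eq0 subr_eq0 addr_eq0.
by case/or3P=> /eqP ->; [constructor 1 | constructor 2 | constructor 3].
Qed.

(** If [-1] were equal to [1], the three cases would leave at most two elements. Hence [1 + 1] is
    not zero, and it is not [1] either. *)
Lemma order3_add11 : (1 + 1 : F) = -1.
Proof.
have N1 : (-1 : F) != 1.
  apply/eqP => N1.
  have : (#|F| <= #|[set 0%R; 1%R : F]|)%N.
    apply: subset_leq_card; apply/subsetP => x _; rewrite in_set2.
    by case: (order3_cases x) => ->; rewrite ?N1 eqxx ?orbT.
  by rewrite card_F cards2; case: (_ != _).
case: (order3_cases (1 + 1)) => // /eqP.
  by rewrite addr_eq0 eq_sym (negPf N1).
by rewrite -subr_eq0 addrK oner_eq0.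
Qed.

(* The change of coordinates from [e] to [f] when [e_i = f_j + f_k]. *)
Lemma order3_on_quadrilateral (x y z : F) :
  one_zero (y + z) (z + x) (x + y) =
  on_quadrilateral x y z && ~~ [&& x == 0, y == 0 & z == 0].
Proof.
have add11 := order3_add11.
have N1N1 : (-1 - 1 : F) = 1 by rewrite -opprD add11 opprK.
have N10 : ((-1 : F) == 0) = false by rewrite oppr_eq0 oner_eq0.
rewrite /one_zero /on_quadrilateral.
case: (order3_cases x) => ->; case: (order3_cases y) => ->; case: (order3_cases z) => ->;
by rewrite ?(addr0, add0r, add11, N1N1, subrr, addNr) ?(eqxx, oner_eq0, N10).
Qed.


Lemma order3_oppD (x : F) : - x - x = x.
Proof.
by rewrite -[x in LHS]mul1r -opprD -mulrDl order3_add11 mulN1r opprK.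
Qed.

(** Together with [order3_differences], this says that the coordinate changes between [e] and [f]
    are mutually inverse; each composite is multiplication by -2, which is 1 here. *)
Lemma order3_sums (x y z : F) :
  [/\ (y - z - x) + (z - x - y) = x, (z - x - y) + (x - y - z) = y
    & (x - y - z) + (y - z - x) = z].
Proof.
by split; [rewrite -[RHS](order3_oppD x) | rewrite -[RHS](order3_oppD y)
  | rewrite -[RHS](order3_oppD z)]; ring.
Qed.

Lemma order3_differences (x y z : F) :
  [/\ (y + z) - (z + x) - (x + y) = x, (z + x) - (x + y) - (y + z) = y
    & (x + y) - (y + z) - (z + x) = z].
Proof.
by split; [rewrite -[RHS](order3_oppD x) | rewrite -[RHS](order3_oppD y)
  | rewrite -[RHS](order3_oppD z)]; ring.
Qed.

(** The matrices of both frame changes are symmetric, so coordinates transform by the same formulas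
    as vectors, in the opposite direction. [order3_on_quadrilateral] then matches the two
    predicates. *)
Lemma order3_quadrilateral_frame (B : {set point F}) :
  (exists e0 e1 e2, frame e0 e1 e2 /\ B = [set P in quadrilateral e0 e1 e2]) <->
  (exists f0 f1 f2, frame f0 f1 f2 /\ in_frame f0 f1 f2 (@one_zero F) B).
Proof.
split=> [[e0 [e1 [e2 [fr /(in_frame_quadrilateral _ fr) BE]]]] | [f0 [f1 [f2 [fr BE]]]]].
  have combE x y z : comb (e0 - e1 - e2) (e1 - e2 - e0) (e2 - e0 - e1) x y z =
      comb e0 e1 e2 (x - y - z) (y - z - x) (z - x - y).
    by apply/rowP => i; rewrite !mxE; ring.
  exists (e0 - e1 - e2), (e1 - e2 - e0), (e2 - e0 - e1); split=> x y z.
    rewrite combE => /fr[a b c]; have [] := order3_sums x y z.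
    by rewrite a b c addr0 => <- <- <-.
  rewrite combE => v0.
  have := order3_on_quadrilateral (x - y - z) (y - z - x) (z - x - y).
  by rewrite BE // -(comb_eq0 fr) v0 andbT; have [-> -> ->] := order3_sums x y z.
have combE x y z : comb (f1 + f2) (f2 + f0) (f0 + f1) x y z =
    comb f0 f1 f2 (y + z) (z + x) (x + y).
  by apply/rowP => i; rewrite !mxE; ring.
have fre : frame (f1 + f2) (f2 + f0) (f0 + f1).
  move=> x y z; rewrite combE => /fr[a b c]; have [] := order3_differences x y z.
  by rewrite a b c !subr0 => <- <- <-.
exists (f1 + f2), (f2 + f0), (f0 + f1); split=> //.
apply/in_frame_quadrilateral => // x y z v0.
rewrite combE BE -?combE // order3_on_quadrilateral.
by rewrite -(comb_eq0 fre) v0 andbT.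
Qed.

End OrderThree.

Theorem theorem3p5 (F : finFieldType) (hF : #|F| = 3) (B : {set pg_point F}) :
  projective_triangle 3 B <-> vertexless_triangle B.
Proof.
apply: iff_trans (projective_triangle_quadrilateral B) _.
apply: iff_trans (order3_quadrilateral_frame hF B) _.
exact: iff_sym (vertexless_triangle_frame B).
Qed.
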